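(* Let $A$ be a vector space with a (not necessarily associative or unital) bilinear product $*$, and let $G$ be the unital formal multiplication on $A$ given by $G(\mu_1\otimes\mu_2)=\epsilon(\mu_2)\pi_A(\mu_1)+\epsilon(\mu_1)\pi_A(\mu_2)+\pi_A(\mu_1)*\pi_A(\mu_2)$ (formally $G(\mathbf{x},\mathbf{y})=\mathbf{x}+\mathbf{y}+\mathbf{x}*\mathbf{y}$). Identify $\mathrm{Prim}(k[G])$ with $A$. Then the Sabinin algebra $\mathrm{Prim}(k[G])$ (Shestakov–Umirbaev operations computed in the bialgebra $k[G]$) coincides with $\mathrm{UX}(A,* )$ (the same operations computed in the algebra $A^\#=k1\oplus A$ obtained by adjoining a unit to $(A,* )$): all operations $\langle x_1,\dots,x_m;y,z\rangle$ and $\Phi^{SU}(x_1,\dots,x_m;y_1,\dots,y_n)$ agree for elements of $A$.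
   Context: $k$ is a field of characteristic $0$; $k[A]$ is the symmetric algebra of $A$ as a coalgebra (elements of $A$ primitive, counit $\epsilon$ the degree-0 projection, $\pi_A$ the projection onto $A$). For a unital formal multiplication $G\colon k[A]\otimes k[A]\to A$, $k[G]$ is $k[A]$ with product $G'(\xi)=\sum_{n\ge0}\frac1{n!}G(\xi_{(1)})\cdots G(\xi_{(n)})$; it is an irreducible bialgebra with $\mathrm{Prim}(k[G])=A$. Shestakov–Umirbaev operations: in the free unital non-associative algebra $k\{S\}$ (a bialgebra with generators primitive), with left division $\sum u_{(1)}\backslash(u_{(2)}v)=\epsilon(u)v=\sum u_{(1)}(u_{(2)}\backslash v)$ and associator $(x,y,z)=(xy)z-x(yz)$, define $p(x_1,\dots,x_m;y_1,\dots,y_n;z)=\sum(u_{(1)}v_{(1)})\backslash(u_{(2)},v_{(2)},z)$ for $u=((x_1x_2)\cdots)x_m$, $v=((y_1y_2)\cdots)y_n$; these polynomials are evaluated in any unital algebra. Then $\langle\,;y,z\rangle=-(yz-zy)$, $\langle x_1,\dots,x_m;y,z\rangle=-p(x_1..x_m;y;z)+p(x_1..x_m;z;y)$, $\Phi^{SU}(x_1,\dots,x_m;y_1,\dots,y_n)=\frac1{m!n!}\sum_{\tau\in S_m,\sigma\in S_n}p(x_{\tau(1)},\dots,x_{\tau(m)};y_{\sigma(1)},\dots,y_{\sigma(n-1)};y_{\sigma(n)})$ ($m\ge1,n\ge2$). *)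

(* Defs.v *)
From HB Require Import structures.
From mathcomp Require Import all_boot all_order all_algebra.
Set Implicit Arguments. Unset Strict Implicit. Unset Printing Implicit Defensive.
Import Order.TTheory GRing.Theory Num.Theory.
Local Open Scope ring_scope.

Record UAlg (k : fieldType) := {
  ucar :> Type;
  uadd : ucar -> ucar -> ucar;
  uopp : ucar -> ucar;
  uscale : k -> ucar -> ucar;
  umul : ucar -> ucar -> ucar;
  uone : ucar;
  uzero : ucar }.

Section SU.
Variables (k : fieldType) (V : UAlg k).

Definition usum (s : seq V) : V := foldr (@uadd k V) (uzero V) s.
Definition usub (x y : V) : V := uadd x (uopp y).
Definition uassoc (x y z : V) : V :=
  usub (umul (umul x y) z) (umul x (umul y z)).

(* Non-associative monomials of the free unital algebra k{S}:          *)
(* leaves are the unit T1 or a generator TV i (generators primitive).  *)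
Inductive tr := T1 | TV of nat | TM of tr & tr.

Fixpoint vars (t : tr) : seq nat :=
  match t with T1 => [::] | TV i => [:: i] | TM l r => vars l ++ vars r end.

Fixpoint restr (P : pred nat) (t : tr) : tr :=
  match t with
  | T1 => T1
  | TV i => if P i then TV i else T1
  | TM l r => TM (restr P l) (restr P r)
  end.

Fixpoint ev (val : nat -> V) (t : tr) : V :=
  match t with
  | T1 => uone V
  | TV i => val i
  | TM l r => umul (ev val l) (ev val r)
  end.

Fixpoint sublists (s : seq nat) : seq (seq nat) :=
  if s is x :: s' then [seq x :: l | l <- sublists s'] ++ sublists s'
  else [:: [::]].

(* Coproduct of a monomial u with distinct generators:                  *)
(*   Delta u = sum_{S subset vars u} u|_S (x) u|_{vars u \ S}.          *)
(* Left division u \ w is the unique solution of                        *)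
(*   sum u_(1) \ (u_(2) w) = eps(u) w, i.e. (recursively on degree)     *)
(*   u \ w = w                              if deg u = 0,              *)
(*   u \ w = - u w - sum_{S proper, nonempty} u|_S \ (u|_{S^c} w).     *)
Fixpoint ldivf (val : nat -> V) (fuel : nat) (u : tr) (w : V) : V :=
  match fuel with
  | 0 => w
  | fuel'.+1 =>
    if vars u is [::] then w else
    uopp (uadd (umul (ev val u) w)
      (usum [seq ldivf val fuel' (restr (fun i => i \in Sx) u)
                   (umul (ev val (restr (fun i => i \notin Sx) u)) w)
            | Sx <- sublists (vars u) & (Sx != [::]) && (size Sx < size (vars u))%N]))
  end.

Definition ldiv (val : nat -> V) (u : tr) (w : V) : V :=
  ldivf val (size (vars u)) u w.

Definition lnorm (ids : seq nat) : tr :=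
  if ids is i :: ids' then foldl (fun t j => TM t (TV j)) (TV i) ids' else T1.

(* p(x_1..x_m; y_1..y_n; z) =                                           *)
(*   sum (u_(1) v_(1)) \ (u_(2), v_(2), z),  u = lnorm xs, v = lnorm ys *)
Definition pSU (xs ys : seq V) (z : V) : V :=
  let m := size xs in let n := size ys in
  let val := nth (uzero V) (xs ++ ys) in
  let u := lnorm (iota 0 m) in let v := lnorm (iota m n) in
  usum [seq ldiv val (TM (restr (fun i => i \in Sx) u) (restr (fun i => i \in Tx) v))
              (uassoc (ev val (restr (fun i => i \notin Sx) u))
                      (ev val (restr (fun i => i \notin Tx) v)) z)
       | Sx <- sublists (iota 0 m), Tx <- sublists (iota m n)].

Definition bracketSU (xs : seq V) (y z : V) : V :=
  if xs is [::] then uopp (usub (umul y z) (umul z y))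
  else uadd (uopp (pSU xs [:: y] z)) (pSU xs [:: z] y).

(* Phi^SU(x_1..x_m; y_1..y_n), for m >= 1, n >= 2 *)
Definition PhiSU (xs ys : seq V) : V :=
  let m := size xs in let n := size ys in
  uscale ((m`! * n`!)%:R^-1)
   (usum [seq pSU [seq nth (uzero V) xs i | i <- tau]
                  [seq nth (uzero V) ys i | i <- take n.-1 sigma]
                  (nth (uzero V) ys (nth 0%N sigma n.-1))
         | tau <- permutations (iota 0 m), sigma <- permutations (iota 0 n)]).

End SU.

Section Asharp.
Variables (k : fieldType) (A : lmodType k) (mulA : A -> A -> A).

Definition Asharp : UAlg k := {|
  ucar := (k * A)%type;
  uadd := fun p q => (p.1 + q.1, p.2 + q.2);
  uopp := fun p => (- p.1, - p.2);
  uscale := fun c p => (c * p.1, c *: p.2);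
  umul := fun p q => (p.1 * q.1, p.1 *: q.2 + q.1 *: p.2 + mulA p.2 q.2);
  uone := (1, 0);
  uzero := (0, 0) |}.

Definition embA (x : A) : Asharp := (0, x).

(* 3. The symmetric algebra k[A]: an element is represented by a formal *)
(*    linear combination of monomials (a monomial = list of elements of *)
(*    A, read as their product in Sym(A)); two representatives denote   *)
(*    the same element of Sym(A) iff they agree under every algebra map *)
(*    induced by a linear map into a commutative k-algebra (universal   *)
(*    property of Sym(A)); see symeq.                                   *)
Definition symel := seq (k * seq A).

Definition evalS (T : comAlgType k) (f : {linear A -> T}) (s : symel) : T :=
  \sum_(p <- s) p.1 *: \prod_(x <- p.2) f x.

Definition symeq (s t : symel) : Prop :=
  forall (T : comAlgType k) (f : {linear A -> T}), evalS f s = evalS f t.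

Definition iotaS (x : A) : symel := [:: (1, [:: x])].

Definition jS (p : k * A) : symel := [:: (p.1, [::]); (1, [:: p.2])].

Definition piA (m : seq A) : A := if m is [:: x] then x else 0.
Definition epsA (m : seq A) : k := if m is [::] then 1 else 0.

Definition Gmul (m1 m2 : seq A) : A :=
  epsA m2 *: piA m1 + epsA m1 *: piA m2 + mulA (piA m1) (piA m2).

Fixpoint assigns (n p : nat) : seq (seq nat) :=
  if p is p'.+1 then [seq i :: l | i <- iota 0 n, l <- assigns n p']
  else [:: [::]].

Definition blk (a : seq A) (f : seq nat) (s : nat) : seq A :=
  [seq x.1 | x <- zip a f & x.2 == s].

(* G'(a (x) b) = sum_n 1/n! sum G(xi_(1)) ... G(xi_(n)) on monomials,  *)
(* where Delta^(n)(a (x) b) distributes the factors of a and of b over  *)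
(* n slots.  Terms with n > deg a + deg b vanish (some slot gets 1(x)1 *)
(* and G(1(x)1) = 0), so the sum is truncated there.                   *)
Definition Gprod (a b : seq A) : symel :=
  flatten [seq [seq ((n`!%:R)^-1, [seq Gmul (blk a f s) (blk b g s) | s <- iota 0 n])
               | f <- assigns n (size a), g <- assigns n (size b)]
          | n <- iota 0 (size a + size b).+1].

Definition kG : UAlg k := {|
  ucar := symel;
  uadd := fun s t => s ++ t;
  uopp := fun s => [seq (- p.1, p.2) | p <- s];
  uscale := fun c s => [seq (c * p.1, p.2) | p <- s];
  umul := fun s t => flatten [seq [seq (p.1 * q.1 * r.1, r.2) | r <- Gprod p.2 q.2]
                             | p <- s, q <- t];
  uone := [:: (1, [::])];
  uzero := [::] |}.

End Asharp.

(* Main.v *)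
Require Import Defs.
From HB Require Import structures.
From mathcomp Require Import all_boot all_order all_algebra.
From mathcomp Require Import ring.
Set Implicit Arguments. Unset Strict Implicit. Unset Printing Implicit Defensive.
Import GRing.Theory.
Local Open Scope ring_scope.

(* Sending a monomial of [k[A]] to its pair (counit, projection onto [A]) is a
   morphism of algebras from [k[G]] to the unital hull of [(A, * )], so it commutes
   with all the operations; it remains to see that in [k[G]] they take primitive
   values.  With square-zero parameters [t_i], the generators become group-like and
   a monomial [u] becomes the exponential of some [l] in [A (x) (t)]; left
   multiplication by it is [evalF f (u b) = evalF f u * evalF (rho_u f) b] with
   [rho_u f = f + f (l * -)], where [rho_u] is linear in [f] and invertible by
   nilpotency.  Hence for [w = u v] the quotient [w \ (u, v, z)] is evaluated by [f]
   to [f z - (rho_v (rho_u (rho_w^-1 f))) z], which is homogeneous of degree 1 in [f].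
   This forces the top coefficient in the parameters, which is [p(x; y; z)], to lie
   in [A]. *)

(** * Dual numbers *)

Section DualNumbers.
Variable k : fieldType.

(** The ring [T[eps]] with [eps^2 = 0]. A Leibniz rule over [T] becomes a product in [dual T], which
    is again a commutative algebra, so inductions over all [T] can repeat the step. *)
Record dual (T : comAlgType k) := dn { re : T; du : T }.

Section Structure.
Variable T : comAlgType k.

Definition dual_pair (z : dual T) : T * T := (re z, du z).
Definition pair_dual (p : T * T) : dual T := dn p.1 p.2.
Lemma dual_pairK : cancel dual_pair pair_dual. Proof. by case. Qed.
HB.instance Definition _ := Choice.copy (dual T) (can_type dual_pairK).

Lemma dualP (z w : dual T) : re z = re w -> du z = du w -> z = w.
Proof. by case: z w => a b [c d] /= -> ->. Qed.

Definition dadd (z w : dual T) := dn (re z + re w) (du z + du w).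
Definition dopp (z : dual T) := dn (- re z) (- du z).
Definition dscale (c : k) (z : dual T) := dn (c *: re z) (c *: du z).
Definition dmul (z w : dual T) := dn (re z * re w) (re z * du w + du z * re w).

Let daddA : associative dadd.
Proof. by move=> x y z; apply: dualP; rewrite /= addrA. Qed.
Let daddC : commutative dadd.
Proof. by move=> x y; apply: dualP; rewrite /= addrC. Qed.
Let dadd0 : left_id (dn 0 0) dadd.
Proof. by move=> x; apply: dualP; rewrite /= add0r. Qed.
Let daddN : left_inverse (dn 0 0) dopp dadd.
Proof. by move=> x; apply: dualP; rewrite /= addNr. Qed.
HB.instance Definition _ := GRing.isZmodule.Build (dual T) daddA daddC dadd0 daddN.

Let dmulA : associative dmul.
Proof. by move=> x y z; apply: dualP; rewrite /=; ring. Qed.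
Let dmulC : commutative dmul.
Proof. by move=> x y; apply: dualP; rewrite /=; ring. Qed.
Let dmul1 : left_id (dn 1 0) dmul.
Proof. by move=> x; apply: dualP; rewrite /=; ring. Qed.
Let dmulDl : left_distributive dmul +%R.
Proof. by move=> x y z; apply: dualP; rewrite /=; ring. Qed.
Let dual_neq0 : dn 1 0 != 0.
Proof. by apply/eqP => /(congr1 (@re T)) /eqP; rewrite oner_eq0. Qed.
HB.instance Definition _ := GRing.Zmodule_isComNzRing.Build (dual T)
  dmulA dmulC dmul1 dmulDl dual_neq0.

Let dscaleA c d z : dscale c (dscale d z) = dscale (c * d) z.
Proof. by apply: dualP; rewrite /= scalerA. Qed.
Let dscale1 : left_id 1 dscale.
Proof. by move=> z; apply: dualP; rewrite /= scale1r. Qed.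
Let dscaleDr : right_distributive dscale +%R.
Proof. by move=> c x y; apply: dualP; rewrite /= scalerDr. Qed.
Let dscaleDl z : {morph dscale^~ z : c d / c + d}.
Proof. by move=> c d; apply: dualP; rewrite /= scalerDl. Qed.
HB.instance Definition _ := GRing.Zmodule_isLmodule.Build k (dual T)
  dscaleA dscale1 dscaleDr dscaleDl.

Let dscaleAl (c : k) (u v : dual T) : c *: (u * v) = (c *: u) * v.
Proof. by apply: dualP; rewrite /= ?scalerDr !scalerAl. Qed.
HB.instance Definition _ := GRing.Lmodule_isLalgebra.Build k (dual T) dscaleAl.
HB.instance Definition _ := GRing.Lalgebra_isComAlgebra.Build k (dual T).

Lemma duM (z w : dual T) : du (z * w) = re z * du w + du z * re w.
Proof. by []. Qed.

Let re_linear : linear (@re T). Proof. by []. Qed.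
Let re_monoid : monoid_morphism (@re T). Proof. by []. Qed.
Let du_linear : linear (@du T). Proof. by []. Qed.
HB.instance Definition _ := GRing.isLinear.Build k (dual T) T _ (@re T) re_linear.
HB.instance Definition _ := GRing.isMonoidMorphism.Build (dual T) T (@re T) re_monoid.
HB.instance Definition _ := GRing.isLinear.Build k (dual T) T _ (@du T) du_linear.

Definition emb (a : T) : dual T := dn a 0.
Let emb_linear : linear emb.
Proof. by move=> c a b; apply: dualP; rewrite /= ?scaler0 ?addr0. Qed.
Let emb_monoid : monoid_morphism emb.
Proof.
by split=> // a b; apply: dualP; rewrite ?duM //= mulr0 mul0r addr0.
Qed.
HB.instance Definition _ := GRing.isLinear.Build k T (dual T) _ emb emb_linear.
HB.instance Definition _ := GRing.isMonoidMorphism.Build T (dual T) emb emb_monoid.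

(** Leibniz rule; [uniq r] makes exactly one factor change in each term. *)
Lemma du_prod (I : eqType) (r : seq I) (p q : I -> T) : uniq r ->
  du (\prod_(s <- r) dn (p s) (q s)) =
  \sum_(i <- r) \prod_(s <- r) (if i == s then q s else p s).
Proof.
elim: r => [|i r IH] /=; first by rewrite !big_nil.
case/andP=> i_r r_uniq; rewrite big_cons duM IH // rmorph_prod /= big_cons.
rewrite big_cons eqxx addrC; congr (_ + _).
  congr (_ * _); apply: eq_big_seq => s s_r /=.
  by case: eqP i_r => // ->; rewrite s_r.
rewrite mulr_sumr; apply: eq_big_seq => j j_r /=.
by rewrite big_cons; case: eqP i_r => // <-; rewrite j_r.
Qed.

End Structure.

Definition mapd (T U : comAlgType k) (j : {lrmorphism T -> U}) (z : dual T) : dual U :=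
  dn (j (re z)) (j (du z)).

Section MapDual.
Variables (T U : comAlgType k) (j : {lrmorphism T -> U}).
Let mapd_linear : linear (mapd j).
Proof. by move=> c a b; apply: dualP; rewrite /= linearP. Qed.
Let mapd_monoid : monoid_morphism (mapd j).
Proof.
split=> [|a b]; apply: dualP; rewrite ?duM /= ?rmorph1 ?rmorph0 //.
  by rewrite rmorphM.
by rewrite rmorphD !rmorphM.
Qed.
HB.instance Definition _ := GRing.isLinear.Build k (dual T) (dual U) _ (mapd j) mapd_linear.
HB.instance Definition _ :=
  GRing.isMonoidMorphism.Build (dual T) (dual U) (mapd j) mapd_monoid.
End MapDual.

End DualNumbers.
(** * The product of [k[G]] as a sum over partial matchings *)

Section Product.
Variables (k : fieldType) (A : lmodType k).
Hypothesis k_pchar0 : [pchar k] =i pred0.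

(** Unlike in [evalS], [f] is a bare function: it will be replaced by functions such as [rho t u f],
    of which mostly the value at [0] has to be controlled. *)
Definition evalF (T : comAlgType k) (f : A -> T) (s : symel A) : T :=
  \sum_(p <- s) p.1 *: \prod_(x <- p.2) f x.

Lemma eq_evalF (T : comAlgType k) (f g : A -> T) s : f =1 g -> evalF f s = evalF g s.
Proof. by move=> fg; apply: eq_bigr => p _; under eq_bigr do rewrite fg. Qed.

Lemma evalF_morph (T U : comAlgType k) (j : {lrmorphism T -> U}) (f : A -> T) s :
  evalF (j \o f) s = j (evalF f s).
Proof.
by rewrite /evalF linear_sum; apply: eq_bigr => p _; rewrite linearZ rmorph_prod.
Qed.

(** With [f (Gmul _ _)] for [h], this is the term of [Gprod] with [n] slots under [f], without its
    factor [1/n!]. *)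
Definition slots (T : comAlgType k) (h : seq A -> seq A -> T) n (a b : seq A) : T :=
  \sum_(u <- assigns n (size a)) \sum_(v <- assigns n (size b))
    \prod_(s <- iota 0 n) h (blk a u s) (blk b v s).

Lemma eq_slots (T : comAlgType k) (h h' : seq A -> seq A -> T) n a b :
  (forall a' b', h a' b' = h' a' b') -> slots h n a b = slots h' n a b.
Proof.
by move=> E; do 2!apply: eq_bigr => ? _; apply: eq_bigr => s _; apply: E.
Qed.

Lemma blk_cons (x : A) a i u s :
  blk (x :: a) (i :: u) s = if i == s then x :: blk a u s else blk a u s.
Proof. by rewrite /blk /=; case: eqP. Qed.

(* Distributing one more letter over the slots is a derivation of the product
   over the slots, hence the [du]-part of a product of dual numbers. *)
Lemma slots_consl (T : comAlgType k) (h : seq A -> seq A -> T) n x a b :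
  slots h n (x :: a) b = du (slots (fun a b => dn (h a b) (h (x :: a) b)) n a b).
Proof.
rewrite /slots /= big_allpairs_dep exchange_big linear_sum.
apply: eq_bigr => u _; rewrite exchange_big linear_sum; apply: eq_bigr => v _.
rewrite /= du_prod ?iota_uniq //; apply: eq_bigr => i _; apply: eq_bigr => s _.
by rewrite blk_cons; case: eqP.
Qed.

Lemma slots_consr (T : comAlgType k) (h : seq A -> seq A -> T) n a y b :
  slots h n a (y :: b) = du (slots (fun a b => dn (h a b) (h a (y :: b))) n a b).
Proof.
rewrite /slots /= linear_sum; apply: eq_bigr => u _.
rewrite big_allpairs_dep exchange_big linear_sum; apply: eq_bigr => v _.
rewrite /= du_prod ?iota_uniq //; apply: eq_bigr => i _; apply: eq_bigr => s _.
by rewrite blk_cons; case: eqP.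
Qed.

Lemma slots_nil (T : comAlgType k) (h : seq A -> seq A -> T) n :
  slots h n [::] [::] = h [::] [::] ^+ n.
Proof.
rewrite /slots /= !big_seq1 /blk /= (big_const_seq _ _ _ _ (h [::] [::])).
by rewrite count_predT size_iota iter_mulr_1.
Qed.

(** The shape of [f (Gmul a b)], with independent values in each case. The value [c] of an empty
    slot is [0] for [Gmul], but the induction in [slots_matchings] fills it with nilpotents. *)
Definition hker (T : comAlgType k) (F f : A -> T) (g : A -> A -> T) (c : T)
    (a b : seq A) : T :=
  match a, b with
  | [::], [::] => c
  | [:: x], [::] => F x
  | [::], [:: y] => f y
  | [:: x], [:: y] => g x y
  | _, _ => 0
  end.

Definition expT (T : comAlgType k) N (c : T) : T :=
  \sum_(n < N.+1) (n`!%:R : k)^-1 *: c ^+ n.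

Lemma dnX (T : comAlgType k) (c d : T) n :
  dn c d ^+ n.+1 = dn (c ^+ n.+1) ((c ^+ n * d) *+ n.+1).
Proof.
elim: n => [|n IH]; first by apply: dualP; rewrite /= ?expr1 // expr0 mul1r.
rewrite exprS IH; apply: dualP; rewrite /= -?exprS //.
by rewrite [in RHS]mulrSr -mulrnAr mulrA -exprS mulrnAr [d * _]mulrC.
Qed.

(** The rule [exp (c + d eps) = exp c * (1 + d eps)]. Differentiation lowers the truncation order by
    one, and [c ^+ N = 0] accounts for the missing top term. *)
Lemma expT_dn (T : comAlgType k) N (c d : T) : c ^+ N = 0 ->
  expT N (dn c d) = emb (expT N c) * dn 1 d.
Proof.
move=> cN; apply: dualP.
  rewrite /expT linear_sum /= mulr1; apply: eq_bigr => -[[|n] ?] _ //=.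
  by rewrite dnX.
rewrite /expT linear_sum big_ord_recl /= scaler0 add0r mul0r addr0.
rewrite big_ord_recr /= cN scaler0 addr0 mulr_suml; apply: eq_bigr => i _.
rewrite /bump leq0n add1n dnX /= -scalerAl -scaler_nat scalerA; congr (_ *: _).
rewrite factS natrM invfM mulrAC mulVf ?mul1r //.
by move/pcharf0P: k_pchar0 => ->.
Qed.

(** Sum over the partial matchings between [a] and [b]: matched pairs contribute [g x y], free
    letters [F x] or [f y]. Matching [y] with one letter of [a] amounts to the [eps] coefficient
    after [F x] becomes [F x + g x y eps]; hence [T] varies in the recursion. *)
Fixpoint matchings (b : seq A) : forall T : comAlgType k,
    (A -> T) -> (A -> T) -> (A -> A -> T) -> seq A -> T :=
  match b with
  | [::] => fun T F f g a => \prod_(x <- a) F x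
  | y :: b' => fun T F f g a =>
      f y * matchings b' F f g a
      + du (matchings b' (fun x => dn (F x) (g x y)) (fun z => emb (f z))
                      (fun x z => emb (g x z)) a)
  end.

Lemma eq_matchings b (T : comAlgType k) (F F' f f' : A -> T) (g g' : A -> A -> T) a :
  F =1 F' -> f =1 f' -> g =2 g' ->
  matchings b F f g a = matchings b F' f' g' a.
Proof.
elim: b T F F' f f' g g' => [|y b IH] T F F' f f' g g' EF Ef Eg /=.
  by apply: eq_bigr => x _; apply: EF.
rewrite Ef (IH _ F F' f f' g g') //; congr (_ + du _).
by apply: IH => x => [| |z]; rewrite ?EF ?Ef ?Eg.
Qed.

Lemma matchings_morph b (T U : comAlgType k) (j : {lrmorphism T -> U})
    (F f : A -> T) (g : A -> A -> T) a :
  matchings b (fun x => j (F x)) (fun x => j (f x)) (fun x y => j (g x y)) a =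
  j (matchings b F f g a).
Proof.
elim: b T U j F f g => [|y b IH] T U j F f g /=; first by rewrite rmorph_prod.
rewrite rmorphD rmorphM IH; congr (_ + _).
transitivity (du (mapd j (matchings b (fun x => dn (F x) (g x y)) (fun z => emb (f z))
                      (fun x z => emb (g x z)) a))); last by [].
rewrite -IH; congr du; apply: eq_matchings => // z => [|u]; apply: dualP => //=;
  by rewrite rmorph0.
Qed.

Lemma dnX_eq0 (T : comAlgType k) (c d : T) n : c ^+ n = 0 -> dn c d ^+ n.+1 = 0.
Proof.
by move=> cn; rewrite dnX; apply: dualP; rewrite /= ?exprS cn ?mulr0 // mul0r mul0rn.
Qed.

(** Letters are removed one by one, first from [b], then from [a], and survive as [eps] coefficients
    in the kernel. Each removal costs one order of nilpotency of [c] ([dnX_eq0]), which the exponent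
    in the hypothesis provides. Empty slots sum to the exponential. *)
Lemma slots_matchings (T : comAlgType k) N (F f : A -> T) (g : A -> A -> T) c a b :
  (size a + size b <= N)%N -> c ^+ (N - (size a + size b)).+1 = 0 ->
  \sum_(n < N.+1) (n`!%:R : k)^-1 *: slots (hker F f g c) n a b =
  expT N c * matchings b F f g a.
Proof.
have expr_leq0 (U : comAlgType k) (e : U) d : (d <= N)%N ->
    e ^+ (N - d) = 0 -> e ^+ N = 0.
  by move=> dN e0; rewrite -(subnK dN) exprD e0 mul0r.
elim: b T F f g c a => [|y b IHb] T F f g c a.
  elim: a T F f g c => [|x a IHa] T F f g c.
    move=> _ _; rewrite /= big_nil mulr1; apply: eq_bigr => n _.
    by rewrite slots_nil.
  rewrite /= addn0 => leN; rewrite subnSK // => cN.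
  transitivity (du (\sum_(n < N.+1) (n`!%:R : k)^-1 *:
      slots (hker (fun z => emb (F z)) (fun y => dn (f y) (g x y))
              (fun x y => emb (g x y)) (dn c (F x))) n a [::])).
    rewrite linear_sum; apply: eq_bigr => n _; rewrite slots_consl linearZ /=.
    by congr (_ *: du _); apply: eq_slots => -[|? [|? ?]] [|? [|? ?]].
  rewrite IHa /= ?addn0 ?(ltnW leN) ?dnX_eq0 //.
  rewrite expT_dn ?(expr_leq0 _ _ _ (ltnW leN)) // big_cons.
  by rewrite -rmorph_prod /= mulr0 add0r mul0r addr0 mulrA.
rewrite /= addnS => leN; rewrite subnSK // => cN.
transitivity (du (\sum_(n < N.+1) (n`!%:R : k)^-1 *:
    slots (hker (fun z => dn (F z) (g z y)) (fun z => emb (f z))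
            (fun x y => emb (g x y)) (dn c (f y))) n a b)).
  rewrite linear_sum; apply: eq_bigr => n _; rewrite slots_consr linearZ /=.
  by congr (_ *: du _); apply: eq_slots => -[|? [|? ?]] [|? [|? ?]].
rewrite IHb /= ?(ltnW leN) ?dnX_eq0 //.
rewrite expT_dn ?(expr_leq0 _ _ _ (ltnW leN)) //=.
set m := matchings b _ _ _ a.
have -> : re m = matchings b F f g a by rewrite /m -matchings_morph.
by ring.
Qed.

(** The case [c = 0] of [slots_matchings], since [Gmul [::] [::] = 0]; the exponential factor is
    then [1]. *)
Lemma evalF_Gprod (mulA : A -> A -> A) (T : comAlgType k) (f : A -> T) a b :
  f 0 = 0 -> (forall x, mulA x 0 = 0) -> (forall x, mulA 0 x = 0) ->
  evalF f (Gprod mulA a b) = matchings b f f (fun x y => f (mulA x y)) a.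
Proof.
move=> f0 mulx0 mul0x.
have -> : matchings b f f (fun x y => f (mulA x y)) a =
    expT (size a + size b) 0 * matchings b f f (fun x y => f (mulA x y)) a.
  rewrite /expT big_ord_recl expr0 fact0 invr1 scale1r big1 ?addr0 ?mul1r //.
  by move=> i _; rewrite expr0n /= scaler0.
rewrite -slots_matchings ?leqnn ?subnn ?expr1 //.
rewrite /evalF /Gprod big_flatten big_map.
rewrite -[iota 0 _.+1]/(index_iota 0 (size a + size b).+1) big_mkord; apply: eq_bigr => n _.
rewrite big_allpairs_dep scaler_sumr; apply: eq_bigr => u _.
rewrite scaler_sumr; apply: eq_bigr => v _ /=; congr (_ *: _).
rewrite big_map; apply: eq_bigr => s _; rewrite /Gmul.
case: (blk a u s) => [|x [|? ?]]; case: (blk b v s) => [|y [|? ?]] /=;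
  rewrite ?(mulx0, mul0x, scale0r, scaler0, scale1r, addr0, add0r) ?f0 //.
Qed.

End Product.
(** * Multiplication by monomials with square-zero parameters *)

Section Subsets.

Lemma big_sublists_cat (R : zmodType) (s1 s2 : seq nat) (phi : seq nat -> R) :
  \sum_(S <- sublists (s1 ++ s2)) phi S =
  \sum_(S1 <- sublists s1) \sum_(S2 <- sublists s2) phi (S1 ++ S2).
Proof.
elim: s1 phi => [|i s1 IH] phi /=; first by rewrite big_seq1.
by rewrite !big_cat !big_map /= !IH.
Qed.

Lemma sublists_sub (s S : seq nat) : S \in sublists s -> {subset S <= s}.
Proof.
elim: s S => [|i s IH] S /=; first by rewrite inE => /eqP->.
rewrite mem_cat => /orP[/mapP[S' /IH subS ->] j|/IH subS j].
  by rewrite !inE => /orP[->//|/subS ->]; rewrite orbT.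
by move/subS; rewrite inE orbC => ->.
Qed.

Lemma eq_in_restr (P Q : pred nat) u : {in vars u, P =1 Q} -> restr P u = restr Q u.
Proof.
elim: u => [|i|l IHl r IHr] //= PQ; first by rewrite PQ ?inE.
by rewrite IHl ?IHr // => i iu; apply: PQ; rewrite mem_cat iu ?orbT.
Qed.

Lemma restr_all (P : pred nat) u : {in vars u, forall i, P i} -> restr P u = u.
Proof.
elim: u => [|i|l IHl r IHr] //= Pu; first by rewrite Pu ?inE.
by rewrite IHl ?IHr // => i iu; apply: Pu; rewrite mem_cat iu ?orbT.
Qed.

Lemma vars_restr P u : vars (restr P u) = filter P (vars u).
Proof. by elim: u => [|i|l IHl r IHr] //=; [case: (P i)|rewrite IHl IHr filter_cat]. Qed.

Lemma restr_restr P Q u : restr P (restr Q u) = restr (fun i => Q i && P i) u.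
Proof. by elim: u => [|i|l IHl r IHr] //=; [case: (Q i)|rewrite IHl IHr]. Qed.

Lemma filter_sublist s S : uniq s -> S \in sublists s -> [seq i <- s | i \in S] = S.
Proof.
elim: s S => [|i s IH] S /=; first by rewrite inE => _ /eqP->.
case/andP=> i_s us; rewrite mem_cat => /orP[/mapP[S' S's ->]|Ss].
  rewrite inE eqxx /=; congr cons; rewrite -[RHS](IH S') //.
  by apply: eq_in_filter => j js; rewrite inE; case: eqP js i_s => // -> ->.
by rewrite ifN ?IH //; apply: contra i_s => /(sublists_sub Ss).
Qed.

Lemma big_sublists_nil (R : zmodType) s (phi : seq nat -> R) :
  \sum_(S <- sublists s) phi S = phi [::] + \sum_(S <- sublists s | S != [::]) phi S.
Proof.
elim: s phi => [|i s IH] phi /=; first by rewrite !big_cons !big_nil /=.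
by rewrite !big_cat !big_map /= [X in _ + X = _]IH addrCA.
Qed.

Lemma filterC_nil s S : uniq s -> S \in sublists s ->
  ([seq i <- s | i \notin S] == [::]) = ~~ (size S < size s)%N.
Proof.
move=> us Ss; rewrite -size_eq0 -leqNgt -[in RHS](count_predC (fun i => i \in S) s).
by rewrite -!size_filter (filter_sublist us Ss) -[X in (_ <= X)%N]addn0 leq_add2l leqn0.
Qed.

Lemma vars_lnorm ids : vars (lnorm ids) = ids.
Proof.
case: ids => //= i ids; rewrite -cat1s -[RHS]/(vars (TV i) ++ ids).
elim: ids (TV i) => [|j ids IH] t /=; first by rewrite cats0.
by rewrite IH /= -catA.
Qed.

End Subsets.

(** * Generating families of the restrictions of a monomial *)

Section Trees.
Variables (k : fieldType) (A : lmodType k) (mulA : A -> A -> A).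
Hypothesis k_pchar0 : [pchar k] =i pred0.
Hypothesis mulx0 : forall x, mulA x 0 = 0.
Hypothesis mul0x : forall x, mulA 0 x = 0.

Notation V := (kG mulA).

Lemma evalF_umul (T : comAlgType k) (f : A -> T) (s b : V) : f 0 = 0 ->
  evalF f (umul s b) = \sum_(p <- s) \sum_(q <- b)
    (p.1 * q.1) *: matchings q.2 f f (fun x y => f (mulA x y)) p.2.
Proof.
move=> f0; rewrite {1}/evalF big_flatten big_allpairs_dep; apply: eq_bigr => p _.
apply: eq_bigr => q _; rewrite big_map -evalF_Gprod // scaler_sumr.
by apply: eq_bigr => r _ /=; rewrite scalerA.
Qed.

Variables (val : nat -> V) (xv : nat -> A).

Definition wf u := uniq (vars u) /\ {in vars u, forall i, val i = iotaS (xv i)}.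

Lemma wf_TM l r : wf (TM l r) ->
  [/\ wf l, wf r, {in vars l, forall i, i \notin vars r} & {in vars r, forall i, i \notin vars l}].
Proof.
case=> /=; rewrite cat_uniq => /and3P[ul /hasPn lr ur] valE; split.
- by split=> // i il; apply: valE; rewrite mem_cat il.
- by split=> // i ir; apply: valE; rewrite mem_cat ir orbT.
- by move=> i il; apply/negP => /lr; rewrite /= il.
- by move=> i /lr.
Qed.

Definition tpow (T : comAlgType k) (t : nat -> T) (S : seq nat) : T := \prod_(i <- S) t i.

(** For linear [phi], this is [phi] on the value of [u] at the elements [1 + t i * xv i], expanded
    in the parameters; these elements are group-like when [t i] has square zero. *)
Definition fam (T : comAlgType k) (t : nat -> T) (u : tr) (phi : V -> T) : T :=
  \sum_(S <- sublists (vars u)) tpow t S * phi (ev val (restr (fun i => i \in S) u)).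

Lemma eq_fam (T : comAlgType k) (t : nat -> T) u (phi psi : V -> T) :
  phi =1 psi -> fam t u phi = fam t u psi.
Proof. by move=> E; apply: eq_bigr => S _; rewrite E. Qed.

Lemma tpow_morph (T U : comAlgType k) (j : {lrmorphism T -> U}) t S :
  tpow (j \o t) S = j (tpow t S).
Proof. by rewrite /tpow rmorph_prod. Qed.

Lemma du_fam (T : comAlgType k) (t : nat -> T) u (phi : V -> dual T) :
  du (fam (@emb _ T \o t) u phi) = fam t u (fun s => du (phi s)).
Proof.
rewrite linear_sum; apply: eq_bigr => S _.
by rewrite tpow_morph /= mul0r addr0.
Qed.

Lemma re_fam (T : comAlgType k) (t : nat -> T) u (phi : V -> dual T) :
  re (fam (@emb _ T \o t) u phi) = fam t u (fun s => re (phi s)).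
Proof. by rewrite linear_sum; apply: eq_bigr => S _; rewrite tpow_morph. Qed.

Lemma fam_cat (T : comAlgType k) (t : nat -> T) l r (phi : V -> V -> T) : wf (TM l r) ->
  \sum_(S <- sublists (vars l ++ vars r)) tpow t S *
     phi (ev val (restr (fun i => i \in S) l)) (ev val (restr (fun i => i \in S) r)) =
  \sum_(S <- sublists (vars r)) tpow t S *
     fam t l (fun s => phi s (ev val (restr (fun i => i \in S) r))).
Proof.
move=> /wf_TM[_ _ lr rl]; rewrite big_sublists_cat exchange_big.
apply: eq_big_seq => S2 S2r /=; rewrite mulr_sumr; apply: eq_big_seq => S1 S1l.
rewrite /tpow big_cat /= mulrCA -mulrA; congr (_ * (_ * phi (ev _ _) (ev _ _))).
- apply: eq_in_restr => i il; rewrite mem_cat.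
  by case: (boolP (i \in S2)) => [/(sublists_sub S2r)|]; rewrite ?orbF // (negPf (lr i il)).
- apply: eq_in_restr => i ir; rewrite mem_cat.
  by case: (boolP (i \in S1)) => [/(sublists_sub S1l)|] //; rewrite (negPf (rl i ir)).
Qed.

(* [lam t u G] is [G] applied, after extension of scalars, to the logarithm of the
   group-like element obtained by evaluating [u] at the exponentials of [t i * xv i]. *)
Fixpoint lam (T : comAlgType k) (t : nat -> T) (u : tr) (G : A -> T) : T :=
  match u with
  | T1 => 0
  | TV i => t i * G (xv i)
  | TM l r => lam t l G + lam t r (fun y => G y + lam t l (fun x => G (mulA x y)))
  end.

Definition rho (T : comAlgType k) (t : nat -> T) (u : tr) (G : A -> T) (y : A) : T :=
  G y + lam t u (fun x => G (mulA x y)).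

Lemma eq_lam (T : comAlgType k) (t : nat -> T) u (G H : A -> T) :
  G =1 H -> lam t u G = lam t u H.
Proof.
elim: u G H => [|i|l IHl r IHr] G H GH //=; first by rewrite GH.
by rewrite (IHl G H) //; congr (_ + _); apply: IHr => y; rewrite GH (IHl _ (fun x => H (mulA x y))).
Qed.

Lemma lam_dn (T : comAlgType k) (t : nat -> T) u (G H : A -> T) :
  lam (@emb _ T \o t) u (fun x => dn (G x) (H x)) = dn (lam t u G) (lam t u H).
Proof.
elim: u G H => [|i|l IHl r IHr] G H //=.
  by apply: dualP; rewrite /= ?mul0r ?addr0.
rewrite IHl (@eq_lam _ _ r _ (fun y => dn (G y + lam t l (fun x => G (mulA x y)))
   (H y + lam t l (fun x => H (mulA x y))))); first by rewrite IHr.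
by move=> y; rewrite IHl.
Qed.

Lemma lamD (T : comAlgType k) (t : nat -> T) u (G H : A -> T) :
  lam t u (fun x => G x + H x) = lam t u G + lam t u H.
Proof.
elim: u G H => [|i|l IHl r IHr] G H //=; rewrite ?addr0 ?mulrDr // IHl.
rewrite addrACA -IHr; congr (_ + _); apply: eq_lam => y.
by rewrite IHl addrACA.
Qed.

Lemma lamZ (T : comAlgType k) (t : nat -> T) u c (G : A -> T) :
  lam t u (fun x => c * G x) = c * lam t u G.
Proof.
elim: u G => [|i|l IHl r IHr] G //=; rewrite ?mulr0 // 1?mulrCA // IHl mulrDr -IHr.
by congr (_ + _); apply: eq_lam => y; rewrite IHl mulrDr.
Qed.

Lemma lam0 (T : comAlgType k) (t : nat -> T) u : lam t u (fun=> 0) = 0.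
Proof. by rewrite -[RHS](mul0r (lam t u (fun=> 0))) -lamZ; apply: eq_lam => x; rewrite mul0r. Qed.

Lemma lam_emb (T : comAlgType k) (t : nat -> T) u (G : A -> T) :
  lam (@emb _ T \o t) u (fun x => emb (G x)) = emb (lam t u G).
Proof. by rewrite /emb lam_dn lam0. Qed.

Lemma rho0 (T : comAlgType k) (t : nat -> T) u (G : A -> T) : G 0 = 0 -> rho t u G 0 = 0.
Proof.
by move=> G0; rewrite /rho G0 add0r -[RHS](lam0 t u); apply: eq_lam => x; rewrite mulx0.
Qed.

(** Group-likeness in infinitesimal form: if the family is the exponential of [l], then moving [F]
    to [F + eps G] multiplies its evaluation by [1 + eps G(l)], and [lam t u G] is [G(l)]. *)
Definition logder u := forall (T : comAlgType k) (t : nat -> T) (F G : A -> T),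
  (forall i, t i * t i = 0) -> F 0 = 0 -> G 0 = 0 ->
  fam t u (fun s => du (evalF (fun x => dn (F x) (G x)) s)) = fam t u (evalF F) * lam t u G.

Definition leftmul u := forall (T : comAlgType k) (t : nat -> T) (f : A -> T) (b : V),
  (forall i, t i * t i = 0) -> f 0 = 0 ->
  fam t u (fun s => evalF f (umul s b)) = fam t u (evalF f) * evalF (rho t u f) b.

Lemma emb_sqr0 (T : comAlgType k) (t : nat -> T) :
  (forall i, t i * t i = 0) -> forall i, (@emb _ T \o t) i * (@emb _ T \o t) i = 0.
Proof. by move=> t2 i /=; rewrite -rmorphM t2 rmorph0. Qed.

(** The letters of [b] act independently: matching [y] means differentiating the family in the
    direction [g _ y], and by [logder] this multiplies it by [lam t u (fun x => g x y)]. *)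
Lemma fam_matchings u b (T : comAlgType k) (t : nat -> T) (F f : A -> T) (g : A -> A -> T) :
  logder u -> (forall i, t i * t i = 0) -> F 0 = 0 -> (forall y, g 0 y = 0) ->
  fam t u (fun s => \sum_(p <- s) p.1 *: matchings b F f g p.2) =
  fam t u (evalF F) * \prod_(y <- b) (f y + lam t u (fun x => g x y)).
Proof.
move=> ld; elim: b T t F f g => [|y b IH] T t F f g t2 F0 g0.
  by rewrite big_nil mulr1.
rewrite big_cons mulrCA mulrDl -{1}IH //.
transitivity (f y * fam t u (fun s => \sum_(p <- s) p.1 *: matchings b F f g p.2) +
  fam t u (fun s => du (\sum_(p <- s) p.1 *: matchings b (fun x => dn (F x) (g x y))
     (fun z => emb (f z)) (fun x z => emb (g x z)) p.2))).
  rewrite /fam mulr_sumr -big_split; apply: eq_bigr => S _ /=.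
  rewrite mulrCA -mulrDr; congr (_ * _).
  rewrite linear_sum mulr_sumr -big_split; apply: eq_bigr => p _ /=.
  by rewrite scalerDr scalerAr.
congr (_ + _); rewrite -du_fam IH //; first last.
- by move=> z; rewrite g0.
- by rewrite F0 g0.
- exact: emb_sqr0.
under eq_bigr do rewrite lam_emb -rmorphD.
rewrite -rmorph_prod duM /= mulr0 add0r du_fam ld //.
by ring.
Qed.

Lemma logder_leftmul u : logder u -> leftmul u.
Proof.
move=> ld T t f b t2 f0.
transitivity (\sum_(q <- b) q.1 *: fam t u (fun s => \sum_(p <- s)
    p.1 *: matchings q.2 f f (fun x y => f (mulA x y)) p.2)).
  rewrite (eq_fam _ _ (fun s => evalF_umul s b f0)) /fam.
  under [RHS]eq_bigr do rewrite scaler_sumr.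
  rewrite exchange_big; apply: eq_bigr => S _ /=.
  rewrite exchange_big mulr_sumr; apply: eq_bigr => q _ /=.
  rewrite scalerAr scaler_sumr; congr (_ * _); apply: eq_bigr => p _.
  by rewrite scalerA mulrC.
rewrite /evalF mulr_sumr; apply: eq_bigr => q _.
rewrite fam_matchings // => [|y]; first by rewrite scalerAr.
by rewrite mul0x.
Qed.

Lemma fam_TM_evalF l r (T : comAlgType k) (t : nat -> T) (f : A -> T) :
  wf (TM l r) -> leftmul l -> (forall i, t i * t i = 0) -> f 0 = 0 ->
  fam t (TM l r) (evalF f) = fam t l (evalF f) * fam t r (evalF (rho t l f)).
Proof.
move=> wlr lml t2 f0; rewrite {1}/fam /= (fam_cat t (fun x y => evalF f (umul x y))) //.
rewrite [in RHS]/fam mulr_sumr.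
by apply: eq_bigr => S _; rewrite lml // mulrCA.
Qed.

(** For a product, left multiplication by [l] factors the family into that of [l] at [F] and that of
    [r] at [rho t l F]. Logarithmic derivatives add up, which is the recursion of [lam] and mirrors
    [x + y + x * y]. *)
Lemma tree_logder u : wf u -> logder u.
Proof.
elim: u => [|i|l IHl r IHr] wu T t F G t2 F0 G0.
- by rewrite /fam /= !big_seq1 /evalF /= !big_seq1 /= !big_nil !scale1r /= !mulr0.
- have vi : val i = iotaS (xv i) by apply: wu.2; rewrite /= inE.
  rewrite /fam /tpow !(big_cons, big_nil) /= inE eqxx /= vi /evalF /iotaS.
  rewrite !(big_cons, big_nil) /= !scale1r /= !(mulr1, mul1r, mulr0, mul0r, addr0, add0r).
  (* [(1 + t F) * (t G) = t G] because [t] has square zero. *)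
  by rewrite mulrDl mul1r mulrACA t2 mul0r add0r.
have [wl wr _ _] := wf_TM wu.
have lml := logder_leftmul (IHl wl).
rewrite -du_fam fam_TM_evalF //; [|exact: emb_sqr0|by rewrite F0 G0].
rewrite duM /= !du_fam !re_fam.
have eqrho y : rho (@emb _ T \o t) l (fun x => dn (F x) (G x)) y =
    dn (rho t l F y) (rho t l G y) by rewrite /rho lam_dn.
rewrite (IHl wl) // (eq_fam _ _ (fun s => congr1 (@du _ T) (eq_evalF s eqrho))).
rewrite (eq_fam _ r (fun s => congr1 (@re _ T) (eq_evalF s eqrho))).
rewrite (IHr wr) ?rho0 // fam_TM_evalF //.
rewrite !(eq_fam _ _ (fun s => esym (evalF_morph (@re _ T) _ s))) /=.
by rewrite /rho; ring.
Qed.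

Lemma tree_leftmul u : wf u -> leftmul u.
Proof. by move/tree_logder/logder_leftmul. Qed.

(** * Nilpotency *)

Lemma tpow_uniq0 (T : comAlgType k) (t : nat -> T) q :
  (forall i, t i * t i = 0) -> ~~ uniq q -> tpow t q = 0.
Proof.
move=> t2; elim: q => //= i q IH; rewrite negb_and negbK /tpow big_cons => /orP[iq|/IH].
  by rewrite (big_rem i iq) /= mulrA t2 mul0r.
by rewrite /tpow => ->; rewrite mulr0.
Qed.

(** Multiplying by further nonempty [tpow t S] must end in [0], because a list longer than [s] with
    entries in [s] repeats a parameter. This solves recursions whose correction terms all carry
    parameters. *)
Lemma tpow_descent (T : comAlgType k) (t : nat -> T) (s : seq nat) (P : T -> Prop) :
  (forall i, t i * t i = 0) -> P 0 ->
  (forall c, (forall S : seq nat, {subset S <= s} -> S != [::] -> P (c * tpow t S)) -> P c) -> P 1.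
Proof.
move=> t2 P0 step; suff descent n q : {subset q <= s} -> (size s < size q + n)%N -> P (tpow t q).
  by have := descent (size s).+1 [::]; rewrite /tpow big_nil; apply.
elim: n q => [|n IH] q qs.
  rewrite addn0 => lt_sq; rewrite tpow_uniq0 //; apply: contraL lt_sq => uq.
  by rewrite -leqNgt uniq_leq_size.
rewrite addnS ltnS => le_sq; apply: step => S Ss S0.
rewrite /tpow -big_cat; apply: IH => [i|]; first by rewrite mem_cat => /orP[/qs|/Ss].
rewrite size_cat -addnA addnCA; case: S S0 {Ss} => //= i S _.
by rewrite addSn ltnS (leq_trans le_sq) // leq_addl.
Qed.

(** Every term of [lam t u G] has a factor [t i * G x] with [i] a generator of [u]. *)
Lemma lam_annihil (T : comAlgType k) (t : nat -> T) u c (G : A -> T) :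
  (forall i x, i \in vars u -> c * t i * G x = 0) -> c * lam t u G = 0.
Proof.
elim: u c G => [|i|l IHl r IHr] c G /= H; rewrite ?mulr0 //.
  by rewrite mulrA H ?inE.
rewrite mulrDr IHl ?IHr ?addr0 // => i x iu; last by apply: H; rewrite mem_cat iu.
rewrite mulrDr H ?mem_cat ?iu ?orbT // add0r -lamZ -[RHS](lam0 t l).
by apply: eq_lam => y; apply: H; rewrite mem_cat iu orbT.
Qed.

(** [rho t u] is the identity minus the operator [N] below. Every use of [N] brings out a parameter,
    so the Neumann series applied to [f] is a finite sum. *)
Lemma rho_surj (T : comAlgType k) (t : nat -> T) u (f : A -> T) :
  (forall i, t i * t i = 0) -> f 0 = 0 ->
  exists2 g : A -> T, g 0 = 0 & rho t u g =1 f.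
Proof.
move=> t2 f0; pose N (h : A -> T) y := - lam t u (fun x => h (mulA x y)).
have iterN0 j : iter j N f 0 = 0.
  case: j => //= j; rewrite /N; suff -> : lam t u (fun x => iter j N f (mulA x 0)) = 0.
    by rewrite oppr0.
  elim: j => [|j IH]; rewrite -[RHS](lam0 t u); apply: eq_lam => x; rewrite mulx0 //=.
  by rewrite /N IH oppr0.
(* The list [q] collects the parameters released by [N]; once longer than [vars u], it repeats one
   of them. *)
have nilN j q y : {subset q <= vars u} -> (size (vars u) < size q + j)%N ->
    tpow t q * iter j N f y = 0.
  elim: j q y => [|j IH] q y qs.
    rewrite addn0 => lt_sq; rewrite tpow_uniq0 ?mul0r //; apply: contraL lt_sq => uq.
    by rewrite -leqNgt uniq_leq_size.
  rewrite addnS => lt_sq; rewrite /= /N mulrN lam_annihil ?oppr0 // => i x iu.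
  have -> : tpow t q * t i = tpow t (i :: q) by rewrite /tpow big_cons mulrC.
  by apply: IH => // j'; rewrite inE => /orP[/eqP->|/qs].
pose g n y := \sum_(j < n) iter j N f y.
have rhog n y : rho t u (g n) y = f y - iter n N f y.
  elim: n => [|n IH].
    rewrite /rho /g /= big_ord0 add0r subrr -[RHS](lam0 t u).
    by apply: eq_lam => x; rewrite big_ord0.
  rewrite /rho /g big_ord_recr /=.
  have -> : lam t u (fun x => \sum_(i < n.+1) iter i N f (mulA x y)) =
      lam t u (fun x => g n (mulA x y)) + lam t u (fun x => iter n N f (mulA x y)).
    by rewrite -lamD; apply: eq_lam => x; rewrite big_ord_recr.
  by rewrite addrACA -/(g n y) -/(rho t u (g n) y) IH [in RHS]/N; ring.
exists (g (size (vars u)).+1) => [|y]; first by rewrite /g big1.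
rewrite rhog -[X in _ - X]mul1r -[1](big_nil 1 *%R xpredT t).
by rewrite (nilN _ [::]) // subr0.
Qed.

(** * Left division *)

(** Overlapping [S] and [S'] produce a squared parameter and vanish; disjoint ones are grouped by
    their union [R]. Multiplying families thus reproduces the sum over the coproduct. *)
Lemma sum_disjoint (T : comAlgType k) (t : nat -> T) s (phi : seq nat -> seq nat -> T) :
  (forall i, t i * t i = 0) -> uniq s ->
  \sum_(S <- sublists s) \sum_(S' <- sublists s) tpow t S * tpow t S' * phi S S' =
  \sum_(R <- sublists s) tpow t R *
    \sum_(S <- sublists R) phi S [seq i <- R | i \notin S].
Proof.
move=> t2; elim: s phi => [|i s IH] phi /=.
  by move=> _; rewrite !big_seq1 /tpow big_nil !mul1r.
case/andP=> i_s us.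
have tpow_cons q : tpow t (i :: q) = t i * tpow t q by rewrite /tpow big_cons.
rewrite !big_cat /= !big_map.
under eq_bigr => S _.
  rewrite big_cat big_map /= big1 => [|S' _]; last first.
    by rewrite !tpow_cons mulrACA t2 !mul0r.
  under eq_bigr do rewrite tpow_cons -!mulrA.
  rewrite add0r -mulr_sumr; over.
rewrite -mulr_sumr /=.
under [X in _ * _ + X]eq_bigr => S _.
  rewrite big_cat big_map /=.
  under eq_bigr do rewrite tpow_cons mulrCA -!mulrA.
  rewrite -mulr_sumr; over.
rewrite big_split -mulr_sumr /= IH // addrA -mulrDr; congr (_ + _).
under [X in _ * (X + _)]eq_bigr do under eq_bigr do rewrite mulrA.
under [X in _ * (_ + X)]eq_bigr do under eq_bigr do rewrite mulrA.
rewrite (IH (fun S S' => phi (i :: S) S')) // (IH (fun S S' => phi S (i :: S'))) //.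
rewrite -big_split mulr_sumr; apply: eq_big_seq => R Rs /=.
rewrite tpow_cons -mulrA -mulrDr; congr (_ * (_ * _)).
have i_R : i \notin R by apply: contra i_s; apply: sublists_sub.
rewrite big_cat big_map /=; congr (_ + _); apply: eq_big_seq => S SR.
  rewrite inE eqxx /=; congr phi; apply: eq_in_filter => j jR.
  by rewrite inE; case: eqP jR i_R => // -> ->.
by rewrite ifT //; apply: contra i_R; apply: sublists_sub.
Qed.

Lemma ldivf_fuel (W : UAlg k) (vl : nat -> W) n m u y :
  uniq (vars u) -> (size (vars u) <= n)%N -> (size (vars u) <= m)%N ->
  ldivf vl n u y = ldivf vl m u y.
Proof.
elim: n m u y => [|n IH] [|m] u y uu //=; case E: (vars u) => [|i s] // len lem.
rewrite -E; congr (uopp (uadd _ (usum _))); apply/eq_in_map => S.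
rewrite mem_filter => /andP[/andP[_ ltS] SE].
apply: IH; rewrite vars_restr ?filter_uniq // filter_sublist //;
  by rewrite -ltnS (leq_trans ltS) // E.
Qed.

Lemma ldivE (W : UAlg k) (vl : nat -> W) u y : uniq (vars u) -> vars u != [::] ->
  ldiv vl u y = uopp (uadd (umul (ev vl u) y)
    (usum [seq ldiv vl (restr (fun i => i \in R) u)
                (umul (ev vl (restr (fun i => i \notin R) u)) y)
          | R <- sublists (vars u) & (R != [::]) && (size R < size (vars u))%N])).
Proof.
move=> uu E; rewrite {1}/ldiv; case Es: (size (vars u)) => [|n] /=.
  by move/size0nil: Es E => ->.
case Ev: (vars u) E => [//|i s] _; rewrite -Ev -Es.
congr (uopp (uadd _ (usum _))); apply/eq_in_map => R.
rewrite mem_filter => /andP[/andP[_ ltR] RE].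
apply: ldivf_fuel; rewrite vars_restr ?filter_uniq // filter_sublist //.
by rewrite -ltnS -Es.
Qed.

Lemma evalF_uadd (T : comAlgType k) (f : A -> T) (s s' : V) :
  evalF f (uadd s s') = evalF f s + evalF f s'.
Proof. by rewrite /evalF big_cat. Qed.

Lemma evalF_uopp (T : comAlgType k) (f : A -> T) (s : V) : evalF f (uopp s) = - evalF f s.
Proof. by rewrite /evalF big_map -sumrN; apply: eq_bigr => p _; rewrite scaleNr. Qed.

Lemma evalF_usum (T : comAlgType k) (f : A -> T) (r : seq V) :
  evalF f (usum r) = \sum_(x <- r) evalF f x.
Proof.
elim: r => [|x r IH] /=; first by rewrite /evalF !big_nil.
by rewrite evalF_uadd IH big_cons.
Qed.

Lemma ldiv_nil u y : vars u = [::] -> ldiv val u y = y.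
Proof. by move=> E; rewrite /ldiv E. Qed.

(** The axiom [sum u_(1) \ (u_(2) y) = eps(u) y] seen through [f]. The term with [u_(1) = u] stands
    apart, without the product by a tree of units. *)
Lemma evalF_ldiv (T : comAlgType k) (f : A -> T) u y : uniq (vars u) ->
  evalF f (ldiv val u y) + \sum_(S <- sublists (vars u) | (size S < size (vars u))%N)
     evalF f (ldiv val (restr (fun i => i \in S) u)
                (umul (ev val (restr (fun i => i \notin S) u)) y)) =
  if vars u == [::] then evalF f y else 0.
Proof.
move=> uu; case: eqP => [E|/eqP E].
  by rewrite E big_cons big_nil /= ldiv_nil // addr0.
have lt0 : (0 < size (vars u))%N by rewrite lt0n size_eq0.
rewrite big_mkcond big_sublists_nil lt0 -big_mkcondr.
rewrite [ldiv val (restr (fun i => i \in [::]) u) _]ldiv_nil; last first.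
  by rewrite vars_restr; elim: (vars u).
rewrite [restr (fun i => i \notin [::]) u]restr_all //.
rewrite ldivE // evalF_uopp evalF_uadd evalF_usum big_map big_filter.
exact: addNr.
Qed.

(** Such trees arise as restrictions to no generator. Multiplication by one of them returns [y] only
    up to evaluation: it is the case of [leftmul] in which [lam] vanishes. *)
Lemma novars_unit (T : comAlgType k) (f : A -> T) u : f 0 = 0 -> vars u = [::] ->
  evalF f (ev val u) = 1 /\ forall y, evalF f (umul (ev val u) y) = evalF f y.
Proof.
have lamn (t : nat -> T) v G : vars v = [::] -> lam t v G = 0.
  elim: v G => [|i|l IHl r IHr] G //= E.
  have [El Er] : vars l = [::] /\ vars r = [::] by case: (vars l) E.
  by rewrite IHl // IHr // addr0.
have mul v y : f 0 = 0 -> vars v = [::] ->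
    evalF f (umul (ev val v) y) = evalF f (ev val v) * evalF f y.
  move=> f0 E; have wv : wf v by split; rewrite E.
  have := tree_leftmul wv y (fun=> mul0r (0 : T)) f0.
  rewrite /fam E !big_seq1 restr_all ?E // /tpow big_nil !mul1r => ->.
  by congr (_ * _); apply: eq_evalF => x; rewrite /rho lamn ?addr0.
move=> f0; suff ev1 : vars u = [::] -> evalF f (ev val u) = 1.
  by move=> E; split=> [|y]; rewrite ?mul // ev1 ?mul1r.
elim: u => [|i|l IHl r IHr] //= E.
  by rewrite /evalF big_seq1 big_nil scale1r.
have [El Er] : vars l = [::] /\ vars r = [::] by case: (vars l) E.
by rewrite mul // IHl // IHr // mul1r.
Qed.

Definition divfam (T : comAlgType k) (t : nat -> T) w (f : A -> T) (y : V) : T :=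
  \sum_(S <- sublists (vars w)) tpow t S *
    evalF f (ldiv val (restr (fun i => i \in S) w) y).

(** Packs the identities [evalF_ldiv] of all restrictions of [w] into one by [sum_disjoint]; the
    counit leaves only [R = [::]] on the right. In effect [divfam] inverts left multiplication by
    the group-like element of [w]. *)
Lemma divfam_rec (T : comAlgType k) (t : nat -> T) w (f : A -> T) (y : V) :
  (forall i, t i * t i = 0) -> uniq (vars w) ->
  divfam t w f y + \sum_(S <- sublists (vars w) | S != [::]) tpow t S *
     divfam t w f (umul (ev val (restr (fun i => i \in S) w)) y) = evalF f y.
Proof.
(* The value [0] at [S' = [::]] avoids counting the term [divfam t w f y] twice. *)
move=> t2 uw; pose phi (S S' : seq nat) := if S' == [::] then 0 else
  evalF f (ldiv val (restr (fun i => i \in S) w)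
             (umul (ev val (restr (fun i => i \in S') w)) y)).
transitivity (divfam t w f y + \sum_(S <- sublists (vars w))
    \sum_(S' <- sublists (vars w)) tpow t S * tpow t S' * phi S S').
  congr (_ + _); rewrite exchange_big big_mkcond; apply: eq_bigr => S' _ /=.
  rewrite /phi; case: eqP => [_|_] /=; first by rewrite big1 // => S _; rewrite mulr0.
  by rewrite mulr_sumr; apply: eq_bigr => S _; rewrite mulrA [tpow t S' * _]mulrC.
rewrite sum_disjoint // -big_split /=.
transitivity (\sum_(R <- sublists (vars w)) tpow t R * (if R == [::] then evalF f y else 0)).
  apply: eq_big_seq => R Rw; rewrite -mulrDr; congr (_ * _).
  have uR : uniq R by rewrite -(filter_sublist uw Rw) filter_uniq.
  have vR : vars (restr (fun i => i \in R) w) = R by rewrite vars_restr filter_sublist.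
  have := @evalF_ldiv _ f (restr (fun i => i \in R) w) y; rewrite vR => <- //.
  congr (_ + _); rewrite [RHS]big_mkcond.
  apply: eq_big_seq => S SR; rewrite /phi filterC_nil // if_neg; case: ifP => // _.
  congr (evalF f (ldiv val _ (umul (ev val _) _))); rewrite restr_restr.
    apply: eq_in_restr => i _; case: (boolP (i \in S)); rewrite ?andbF ?andbT //.
    by move/(sublists_sub SR).
  by apply: eq_in_restr => i _; rewrite mem_filter andbC.
rewrite big_sublists_nil /= big1 ?addr0 => [|R /negPf->]; last by rewrite mulr0.
by rewrite /tpow big_nil mul1r.
Qed.

(** The family evaluates to [1] plus terms carrying parameters, hence can be cancelled. *)
Lemma fam_cancel (T : comAlgType k) (t : nat -> T) w (g : A -> T) x :
  (forall i, t i * t i = 0) -> g 0 = 0 -> fam t w (evalF g) * x = 0 -> x = 0.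
Proof.
move=> t2 g0 ex; rewrite -[x]mul1r.
apply: (@tpow_descent _ t (vars w) (fun c => c * x = 0)) => // [|c H].
  by rewrite mul0r.
rewrite -[RHS](mulr0 c) -ex /fam big_sublists_nil [tpow t [::]]big_nil mul1r.
rewrite (proj1 (novars_unit g0 _)) ?vars_restr; last by elim: (vars w).
rewrite mulrDl mul1r mulrDr mulr_suml mulr_sumr big1_seq ?addr0 // => S /andP[S0 Sw].
by rewrite mulrAC !mulrA H ?mul0r //; apply: sublists_sub.
Qed.

(** By [leftmul] and [divfam_rec], the difference [dl] of the two sides satisfies a homogeneous
    recursion whose other terms carry parameters; nilpotency forces it to be [0]. *)
Lemma divfamE (T : comAlgType k) (t : nat -> T) w (g : A -> T) (y : V) :
  (forall i, t i * t i = 0) -> g 0 = 0 -> wf w ->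
  fam t w (evalF g) * divfam t w (rho t w g) y = evalF g y.
Proof.
move=> t2 g0 ww; set e := fam t w _; set f := rho t w g.
pose dl y := e * divfam t w f y - evalF g y.
have dl_rec z : dl z + \sum_(S <- sublists (vars w) | S != [::]) tpow t S *
     dl (umul (ev val (restr (fun i => i \in S) w)) z) = 0.
  have := tree_leftmul ww z t2 g0; rewrite -/f -/e -(divfam_rec f z t2 ww.1).
  rewrite {1}/fam big_sublists_nil [tpow t [::]]big_nil mul1r.
  rewrite (proj2 (novars_unit g0 _)) ?vars_restr; last by elim: (vars w).
  rewrite mulrDr mulr_sumr => E; rewrite /dl.
  under eq_bigr do rewrite mulrBr mulrCA.
  by rewrite sumrB addrACA -opprD E subrr.
suff dl0 : forall z, 1 * dl z = 0.
  by apply/eqP; rewrite -subr_eq0; have := dl0 y; rewrite mul1r /dl => ->.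
apply: (@tpow_descent _ t (vars w) (fun c => forall z, c * dl z = 0)) => // [z|c H z].
  by rewrite mul0r.
rewrite -[RHS](mulr0 c) -(dl_rec z) [RHS]mulrDr mulr_sumr big1_seq ?addr0 // => S /andP[S0 Sw].
by rewrite mulrA H //; apply: sublists_sub.
Qed.

(** After multiplication by the family of [TM u v], [divfamE] removes the division. Then [(u v) z]
    is one left multiplication and [u (v z)] is two, with the common factor
    [fam t (TM u v) (evalF g)], which [fam_cancel] removes. *)
Lemma divfam_assoc (T : comAlgType k) (t : nat -> T) u v (g : A -> T) (z : A) :
  (forall i, t i * t i = 0) -> g 0 = 0 -> wf (TM u v) ->
  \sum_(S <- sublists (vars (TM u v))) tpow t S *
     divfam t (TM u v) (rho t (TM u v) g)
       (uassoc (ev val (restr (fun i => i \in S) u)) (ev val (restr (fun i => i \in S) v))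
               (iotaS z)) =
  rho t (TM u v) g z - rho t v (rho t u g) z.
Proof.
move=> t2 g0 ww; have [wu wv _ _] := wf_TM ww.
have lmu := tree_leftmul wu; have lmv := tree_leftmul wv.
have evalF1 (h : A -> T) : evalF h (iotaS z) = h z.
  by rewrite /evalF !big_seq1 scale1r.
apply/eqP; rewrite -subr_eq0; apply/eqP; apply: (@fam_cancel _ t (TM u v) g) => //.
apply/eqP; rewrite mulrBr subr_eq0 mulr_sumr; apply/eqP.
under eq_bigr do rewrite mulrCA divfamE // evalF_uadd evalF_uopp mulrDr mulrN.
rewrite sumrB mulrBr; congr (_ - _).
  by rewrite -[X in _ * X](evalF1 (rho t (TM u v) g)) -tree_leftmul.
rewrite (fam_cat t (fun x y => evalF g (umul x (umul y (iotaS z))))) //.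
under eq_bigr do rewrite lmu // mulrCA.
rewrite -mulr_sumr fam_TM_evalF // -mulrA -[rho t v _ z]evalF1; congr (_ * _).
by apply: lmv => //; apply: rho0.
Qed.

(** * Primitivity *)

(** [U] stacks one layer of dual numbers over [T] for each generator in [s], [t i] is the [eps] of
    the layer of [i], and [top] reads the [eps] coefficient in every layer. *)
Lemma top_coefficient (T : comAlgType k) s : uniq s ->
  exists (U : comAlgType k) (j : {lrmorphism T -> U}) (t : nat -> U) (top : U -> T),
    (forall i, t i * t i = 0) /\
    forall psi : seq nat -> T, top (\sum_(R <- sublists s) tpow t R * j (psi R)) = psi s.
Proof.
elim: s => [_|i s IH /= /andP[i_s us]].
  exists T, idfun, (fun=> 0), id; split=> [i|psi]; first by rewrite mul0r.
  by rewrite big_seq1 /tpow big_nil mul1r.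
have [U [j [t [top [t2 topE]]]]] := IH us.
exists (dual U), (@emb _ U \o j), (fun n => if n == i then dn 0 1 else emb (t n)),
  (fun z => top (du z)); split=> [n|psi].
  case: eqP => _; last by rewrite -rmorphM t2 rmorph0.
  by apply: dualP; rewrite /= !mul0r ?mulr0 ?addr0.
rewrite -[RHS](topE (fun R => psi (i :: R))); congr top.
rewrite big_cat big_map /= !(linear_sum (@du _ U)) /=.
have tpowE R : R \in sublists s ->
    tpow (fun n => if n == i then dn 0 1 else emb (t n)) R = emb (tpow t R).
  move=> Rs; rewrite /tpow rmorph_prod; apply: eq_big_seq => n /(sublists_sub Rs) ns.
  by case: eqP ns i_s => // -> ->.
rewrite [X in _ + X]big1_seq => [|R Rs]; last first.
  by rewrite tpowE //= mulr0 mul0r addr0.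
rewrite addr0; apply: eq_big_seq => R Rs.
have := tpowE R Rs; rewrite /tpow big_cons eqxx => -> /=.
by rewrite !(mul0r, mulr0, mul1r, add0r, addr0).
Qed.

(** Scaling [f] by [c] multiplies the part of degree [d] by [c ^+ d]; letting [c] range over all
    algebras [T] singles out degree 1, that is, [A] inside the symmetric algebra. *)
Definition homog (s : V) := forall (T : comAlgType k) (c : T) (f : A -> T),
  f 0 = 0 -> evalF (fun x => c * f x) s = c * evalF f s.

(** The coefficient of [tpow t R] in the left side of [divfam_assoc], with [f] for
    [rho t (TM u v) g]. For [R] the full list it is [p] under [f]. *)
Definition quotient_assoc u v z (R : seq nat) (T : comAlgType k) (f : A -> T) : T :=
  \sum_(S <- sublists R) evalF f (ldiv val (restr (fun i => i \in S) (TM u v))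
    (uassoc (ev val (restr (fun i => i \in [seq j <- R | j \notin S]) u))
            (ev val (restr (fun i => i \in [seq j <- R | j \notin S]) v)) (iotaS z))).

(** All coefficients are gathered in [Gam], where [rho_surj] makes [divfam_assoc] applicable, and
    its right side is linear in [g]. The top coefficient of the resulting equality is the claim. *)
Lemma quotient_assocZ u v z (T : comAlgType k) (c : T) (f : A -> T) :
  wf (TM u v) -> f 0 = 0 ->
  quotient_assoc u v z (vars (TM u v)) (fun x => c * f x) =
  c * quotient_assoc u v z (vars (TM u v)) f.
Proof.
move=> ww f0; set s := vars _; set q := quotient_assoc u v z.
have [U [j [t [top [t2 topE]]]]] := top_coefficient T ww.1.
pose Gam (F : A -> U) := \sum_(S <- sublists s) tpow t S * divfam t (TM u v) F
       (uassoc (ev val (restr (fun i => i \in S) u)) (ev val (restr (fun i => i \in S) v))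
               (iotaS z)).
have eq_Gam F H : F =1 H -> Gam F = Gam H.
  move=> FH; apply: eq_bigr => S _; congr (_ * _); apply: eq_bigr => S' _.
  by congr (_ * _); apply: eq_evalF.
have GamE (h : A -> T) : Gam (j \o h) = \sum_(R <- sublists s) tpow t R * j (q R T h).
  rewrite /Gam; under eq_bigr do rewrite mulr_sumr.
  rewrite exchange_big.
  under eq_bigr do under eq_bigr do rewrite mulrCA mulrA.
  rewrite (sum_disjoint (fun S S' => evalF (j \o h)
      (ldiv val (restr (fun i => i \in S) (TM u v))
         (uassoc (ev val (restr (fun i => i \in S') u))
            (ev val (restr (fun i => i \in S') v)) (iotaS z)))) t2 ww.1).
  apply: eq_bigr => R _; congr (_ * _); rewrite /q /quotient_assoc linear_sum.
  by apply: eq_bigr => S _; rewrite evalF_morph.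
have GamZ : Gam (j \o (fun x => c * f x)) = j c * Gam (j \o f).
  have jf0 : (j \o f) 0 = 0 by rewrite /= f0 rmorph0.
  have [g g0 gE] := rho_surj (TM u v) t2 jf0.
  have rhoZ w (h : A -> U) y : rho t w (fun x => j c * h x) y = j c * rho t w h y.
    by rewrite /rho lamZ mulrDr.
  have eq_rho w (h h' : A -> U) y : h =1 h' -> rho t w h y = rho t w h' y.
    by move=> E; rewrite /rho E; congr (_ + _); apply: eq_lam => x.
  have -> : Gam (j \o (fun x => c * f x)) = Gam (rho t (TM u v) (fun x => j c * g x)).
    by apply: eq_Gam => x; rewrite rhoZ gE /= rmorphM.
  have -> : Gam (j \o f) = Gam (rho t (TM u v) g) by apply: eq_Gam => x; rewrite gE.
  rewrite /Gam !divfam_assoc // ?g0 ?mulr0 // rhoZ mulrBr; congr (_ - _).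
  by rewrite -rhoZ; apply: eq_rho => y; rewrite rhoZ.
rewrite -(topE (fun R => q R T (fun x => c * f x))) -GamE GamZ GamE.
rewrite -[RHS](topE (fun R => c * q R T f)) mulr_sumr; congr top.
by apply: eq_bigr => R _; rewrite rmorphM mulrCA.
Qed.
End Trees.

(** * The Shestakov-Umirbaev operations *)

Section Morphism.
Variables (k : fieldType) (W W' : UAlg k) (phi : W -> W').
Hypothesis phiD : forall x y, phi (uadd x y) = uadd (phi x) (phi y).
Hypothesis phiN : forall x, phi (uopp x) = uopp (phi x).
Hypothesis phiZ : forall c x, phi (uscale c x) = uscale c (phi x).
Hypothesis phiM : forall x y, phi (umul x y) = umul (phi x) (phi y).
Hypothesis phi1 : phi (uone W) = uone W'.
Hypothesis phi0 : phi (uzero W) = uzero W'.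

Lemma usum_morph (r : seq W) : phi (usum r) = usum (map phi r).
Proof. by elim: r => //= x r IH; rewrite phiD IH. Qed.

Lemma ev_morph vl vl' u : (forall i, phi (vl i) = vl' i) -> phi (ev vl u) = ev vl' u.
Proof. by move=> E; elim: u => //= l IHl r IHr; rewrite phiM IHl IHr. Qed.

Lemma ldivf_morph vl vl' n u y : (forall i, phi (vl i) = vl' i) ->
  phi (ldivf vl n u y) = ldivf vl' n u (phi y).
Proof.
move=> E; elim: n u y => //= n IH u y; case: (vars u) => // i s.
rewrite phiN phiD phiM (ev_morph _ E) usum_morph; congr (uopp (uadd _ (usum _))).
by rewrite -map_comp; apply: eq_map => R /=; rewrite IH phiM (ev_morph _ E).
Qed.

Lemma nth_morph s i : phi (nth (uzero W) s i) = nth (uzero W') (map phi s) i.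
Proof. by elim: s i => [|x s IH] [|i] //=; rewrite ?phi0. Qed.

Lemma pSU_morph xs ys z : phi (pSU xs ys z) = pSU (map phi xs) (map phi ys) (phi z).
Proof.
rewrite /pSU !size_map.
have E i : phi (nth (uzero W) (xs ++ ys) i) = nth (uzero W') (map phi xs ++ map phi ys) i.
  by rewrite nth_morph map_cat.
rewrite usum_morph map_allpairs; congr usum; apply: eq_allpairs => // S1 S2.
rewrite /ldiv (ldivf_morph _ _ _ E) /uassoc /usub phiD phiN !phiM.
by rewrite !(ev_morph _ E).
Qed.

Lemma bracketSU_morph xs y z :
  phi (bracketSU xs y z) = bracketSU (map phi xs) (phi y) (phi z).
Proof.
case: xs => [|x xs] /=; first by rewrite phiN /usub phiD phiN !phiM.
by rewrite phiD phiN !(pSU_morph (x :: xs)).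
Qed.

Lemma PhiSU_morph xs ys : phi (PhiSU xs ys) = PhiSU (map phi xs) (map phi ys).
Proof.
rewrite /PhiSU phiZ !size_map usum_morph map_allpairs; congr (uscale _ (usum _)).
apply: eq_allpairs => // tau sigma; rewrite pSU_morph -!map_comp nth_morph.
by congr pSU; apply: eq_map => i /=; rewrite nth_morph.
Qed.

End Morphism.

(** * The projection onto the unital hull, and primitivity of the operations *)

Section Bilinear.
Variables (k : fieldType) (A : lmodType k) (mulA : A -> A -> A).
Hypothesis k_pchar0 : [pchar k] =i pred0.
Hypothesis mulA_linl : forall (c : k) (x x' y : A),
  mulA (c *: x + x') y = c *: mulA x y + mulA x' y.
Hypothesis mulA_linr : forall (c : k) (x y y' : A),
  mulA x (c *: y + y') = c *: mulA x y + mulA x y'.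

Notation V := (kG mulA).

Let mul0x y : mulA 0 y = 0.
Proof. by have := mulA_linl (-1) 0 0 y; rewrite !scaleN1r !addNr. Qed.
Let mulx0 y : mulA y 0 = 0.
Proof. by have := mulA_linr (-1) y 0 0; rewrite !scaleN1r !addNr. Qed.

Definition phiG (s : V) : Asharp mulA :=
  (\sum_(p <- s) p.1 * epsA p.2, \sum_(p <- s) p.1 *: piA p.2).

(** Terms of [Gprod] with [n] slots are monomials of degree [n], so the counit sees only [n = 0] and
    the projection onto [A] only [n = 1], where all letters share one slot. *)
Lemma phiG_Gprod a b :
  phiG (Gprod mulA a b) = (epsA a * epsA b, Gmul mulA a b).
Proof.
rewrite /phiG /Gprod !big_flatten !big_map /= !big_cons; congr (_, _).
  rewrite [X in _ + X]big1_seq ?addr0 => [|n]; last first.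
    rewrite mem_iota andTb => /andP[n1 _].
    rewrite big_allpairs_dep !big1 // => u _; rewrite big1 // => v _ /=.
    by case: n n1 => // n _; rewrite mulr0.
  rewrite big_allpairs_dep; case: a => [|x a]; case: b => [|y b] /=;
    by rewrite ?big_seq1 ?big_nil ?(mulr1, mulr0, mul0r) ?invr1 // big_seq1 big_nil.
rewrite [X in X + _]big_allpairs_dep /=.
rewrite [X in X + _]big1 ?add0r => [|u _]; last by rewrite big1 // => v _; rewrite scaler0.
have vanish m : \sum_(n <- iota 2 m) \sum_(p <- [seq ((n`!%:R : k)^-1,
      [seq Gmul mulA (blk a f s) (blk b g s) | s <- iota 0 n])
    | f <- assigns n (size a), g <- assigns n (size b)]) p.1 *: piA p.2 = 0.
  rewrite big1_seq // => n; rewrite mem_iota andTb => /andP[n2 _].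
  rewrite big_allpairs_dep !big1 // => u _; rewrite big1 // => v _ /=.
  by case: n n2 => [|[|n]] // _; rewrite scaler0.
have assigns1 p : assigns 1 p = [:: nseq p 0%N] by elim: p => //= p ->.
have blk0 (c : seq A) : blk c (nseq (size c) 0%N) 0 = c.
  by rewrite /blk; elim: c => //= x c ->.
(* For two empty monomials the sum stops before [n = 1], and [Gmul] is [0]. *)
case E : (size a + size b)%N => [|m] /=.
  move/eqP: E; rewrite addn_eq0 !size_eq0 => /andP[/eqP-> /eqP->].
  by rewrite big_nil /Gmul /= !scaler0 mulx0 !addr0.
by rewrite big_cons vanish addr0 big_allpairs_dep !assigns1 !big_seq1 /= !blk0 invr1 scale1r.
Qed.

Lemma phiGM (s s' : V) : phiG (umul s s') = umul (phiG s) (phiG s').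
Proof.
have phi_umul : phiG (umul s s') =
    (\sum_(p <- s) \sum_(q <- s') p.1 * q.1 * (epsA p.2 * epsA q.2),
     \sum_(p <- s) \sum_(q <- s') (p.1 * q.1) *: Gmul mulA p.2 q.2).
  rewrite {1}/phiG; congr (_, _); rewrite big_flatten big_allpairs_dep;
    apply: eq_bigr => p _; apply: eq_bigr => q _; rewrite big_map;
    have [E1 E2] := phiG_Gprod p.2 q.2.
  - by rewrite -E1 mulr_sumr; apply: eq_bigr => r _; rewrite mulrA.
  - by rewrite -E2 scaler_sumr; apply: eq_bigr => r _; rewrite scalerA.
rewrite phi_umul /phiG /=; congr (_, _).
  rewrite mulr_suml; apply: eq_bigr => p _; rewrite mulr_sumr.
  by apply: eq_bigr => q _; rewrite mulrACA.
have mulA_suml y : mulA (\sum_(p <- s) p.1 *: piA p.2) y = \sum_(p <- s) p.1 *: mulA (piA p.2) y.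
  by elim: (s : seq _) => [|p r IH]; rewrite ?big_nil ?mul0x // !big_cons mulA_linl IH.
have mulA_sumr x : mulA x (\sum_(p <- s') p.1 *: piA p.2) = \sum_(p <- s') p.1 *: mulA x (piA p.2).
  by elim: (s' : seq _) => [|p r IH]; rewrite ?big_nil ?mulx0 // !big_cons mulA_linr IH.
rewrite mulA_suml !scaler_suml.
rewrite [X in _ + X + _](_ : _ =
  \sum_(p <- s) \sum_(q <- s') (q.1 * epsA q.2) *: (p.1 *: piA p.2)); last first.
  by rewrite exchange_big; apply: eq_bigr => q _; rewrite scaler_sumr.
rewrite -!big_split; apply: eq_bigr => p _ /=.
rewrite mulA_sumr !scaler_sumr -!big_split; apply: eq_bigr => q _ /=.
rewrite /Gmul !scalerDr !scalerA; congr (_ + _); rewrite addrC.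
by congr (_ *: _ + _ *: _); ring.
Qed.

Lemma phiGD (s s' : V) : phiG (uadd s s') = uadd (phiG s) (phiG s').
Proof. by rewrite /phiG !big_cat. Qed.

Lemma phiGN (s : V) : phiG (uopp s) = uopp (phiG s).
Proof.
rewrite /phiG !big_map /= -!sumrN; congr (_, _); apply: eq_bigr => p _ /=.
  by rewrite mulNr.
by rewrite scaleNr.
Qed.

Lemma phiGZ c (s : V) : phiG (uscale c s) = uscale c (phiG s).
Proof.
rewrite /phiG !big_map /= mulr_sumr scaler_sumr.
by congr (_, _); apply: eq_bigr => p _ /=; rewrite ?mulrA ?scalerA.
Qed.

Lemma phiG1 : phiG (uone V) = uone (Asharp mulA).
Proof. by rewrite /phiG !big_seq1 /= mulr1 scaler0. Qed.

Lemma phiG0 : phiG (uzero V) = uzero (Asharp mulA).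
Proof. by rewrite /phiG !big_nil. Qed.

Lemma phiG_iota x : phiG (iotaS x) = embA mulA x.
Proof. by rewrite /phiG !big_seq1 /= mulr0 scale1r. Qed.

(* Homogeneity for the scalar [eps] of the dual numbers kills the components of
   degree different from 1. *)
Lemma homog_symeq (s : V) : homog s -> symeq s (jS (phiG s)).
Proof.
move=> hs T f; have f0 : emb (f 0) = 0 by rewrite linear0 rmorph0.
have := hs (dual T) (dn 0 1) (@emb _ T \o f) f0; rewrite evalF_morph.
(* As [eps^2 = 0], only monomials of degree 0 and 1 survive the scaling. *)
have prodE m : \prod_(x <- m) (dn 0 1 * (@emb _ T \o f) x) =
    dn ((epsA m)%:A) (f (piA m)).
  case: m => [|x [|y m]].
  - by rewrite big_nil scale1r linear0.
  - by rewrite big_seq1 scale0r; apply: dualP; rewrite /= ?mul0r ?mul1r ?add0r.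
  - rewrite !big_cons mulrA mulrACA.
    have -> : dn 0 1 * dn 0 1 = 0 :> dual T.
      by apply: dualP; rewrite /= !mul0r ?mulr0 ?addr0.
    by rewrite !mul0r scale0r linear0.
rewrite {1}/evalF; under eq_bigr do rewrite prodE.
move Ee : (evalF f s) => e E; have := congr1 (@du _ T) E; have := congr1 (@re _ T) E.
(* The [re] part says that the counit of [s] vanishes in [T], the [du] part that [evalF f s] is [f]
   of the component in [A]. *)
rewrite !linear_sum /= !mul0r !add0r mul1r => E1 E2.
rewrite /evalS -[LHS]/(evalF f s) Ee -E2 big_cons big_seq1 /= big_nil big_seq1 scale1r.
rewrite scaler_suml linear_sum.
under [X in _ = X + _]eq_bigr do rewrite -scalerA.
by rewrite E1 add0r; apply: eq_bigr => p _; rewrite linearZ.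
Qed.

Lemma homog_add (s s' : V) : homog s -> homog s' -> homog (uadd s s' : V).
Proof. by move=> hs hs' T c f f0; rewrite !evalF_uadd hs // hs' // mulrDr. Qed.

Lemma homog_opp (s : V) : homog s -> homog (uopp s : V).
Proof. by move=> hs T c f f0; rewrite !evalF_uopp hs // mulrN. Qed.

Lemma homog_scale a (s : V) : homog s -> homog (uscale a s : V).
Proof.
have evalFZ (T : comAlgType k) (f : A -> T) : evalF f (uscale a s : V) = a *: evalF f s.
  by rewrite /evalF big_map scaler_sumr; apply: eq_bigr => p _; rewrite scalerA.
by move=> hs T c f f0; rewrite !evalFZ hs // scalerAr.
Qed.

(** The symmetric part [f y * f z] cancels in the commutator; what remains is linear in [f]. *)
Lemma homog_comm y z : homog (usub (umul (iotaS y : V) (iotaS z)) (umul (iotaS z : V) (iotaS y))).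
Proof.
move=> T c f f0; have cf0 : c * f 0 = 0 by rewrite f0 mulr0.
rewrite !evalF_uadd !evalF_uopp !evalF_umul // !big_seq1 /= !big_seq1 /= !mulr1.
by rewrite !scale1r; ring.
Qed.

(** A pair [Sx], [Tx] amounts to the single sublist [Sx ++ Tx] of the generators of [u v], so [pSU]
    is the top coefficient [quotient_assoc]. *)
Lemma homog_pSU xs ys z :
  homog (pSU (map (@iotaS k A) xs : seq V) (map (@iotaS k A) ys) (iotaS z)).
Proof.
move=> T c f f0; rewrite /pSU !size_map.
set m := size xs; set n := size ys; set vl := nth _ _.
set u := lnorm (iota 0 m); set v := lnorm (iota m n).
pose xv := nth 0 (xs ++ ys).
have uvE : vars u ++ vars v = iota 0 (m + n) by rewrite !vars_lnorm -iotaD.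
have wuv : wf vl xv (TM u v).
  split=> [|i] /=; rewrite uvE ?iota_uniq // mem_iota /= add0n => i_mn.
  by rewrite /vl -map_cat (nth_map 0) // size_cat.
have [_ _ uv vu] := wf_TM wuv.
have pE (h : A -> T) : evalF h (usum [seq ldiv vl
      (TM (restr (fun i => i \in Sx) u) (restr (fun i => i \in Tx) v))
         (uassoc (ev vl (restr (fun i => i \notin Sx) u))
                 (ev vl (restr (fun i => i \notin Tx) v)) (iotaS z))
       | Sx <- sublists (iota 0 m), Tx <- sublists (iota m n)]) =
    quotient_assoc vl u v z (vars (TM u v)) h.
  rewrite evalF_usum big_allpairs_dep /quotient_assoc -[vars (TM u v)]/(vars u ++ vars v).
  rewrite big_sublists_cat !vars_lnorm.
  apply: eq_big_seq => S1 S1u; apply: eq_big_seq => S2 S2v.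
  have inS1 i : i \in vars u -> (i \in S1 ++ S2) = (i \in S1).
    move=> iu; rewrite mem_cat; case: (boolP (i \in S2)); rewrite ?orbF //.
    by move/(sublists_sub S2v); rewrite -(vars_lnorm (iota m n)) -/v (negPf (uv i iu)).
  have inS2 i : i \in vars v -> (i \in S1 ++ S2) = (i \in S2).
    move=> iv; rewrite mem_cat; case: (boolP (i \in S1)) => //.
    by move/(sublists_sub S1u); rewrite -(vars_lnorm (iota 0 m)) -/u (negPf (vu i iv)).
  rewrite -[restr _ (TM u v)]/(TM (restr _ u) (restr _ v)).
  congr (evalF h (ldiv vl (TM _ _) (uassoc (ev vl _) (ev vl _) _)));
    apply: eq_in_restr => i iu.
  - by rewrite inS1.
  - by rewrite inS2.
  - by rewrite mem_filter inS1 // -(vars_lnorm (iota 0 m)) mem_cat iu andbT.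
  - by rewrite mem_filter inS2 // -(vars_lnorm (iota m n)) mem_cat iu orbT andbT.
by rewrite !pE (quotient_assocZ k_pchar0 mulx0 mul0x z c wuv f0).
Qed.

Lemma homog_PhiSU xs ys : (1 < size ys)%N ->
  homog (PhiSU (map (@iotaS k A) xs : seq V) (map (@iotaS k A) ys)).
Proof.
move=> ys1; apply: homog_scale => T c f f0.
rewrite !evalF_usum !big_allpairs_dep mulr_sumr !size_map.
apply: eq_big_seq => tau tauP; rewrite mulr_sumr; apply: eq_big_seq => sigma sigmaP.
(* Indices must stay in range: the default [uzero] is the empty combination, whereas [iotaS 0] is
   not. *)
have nthE (zs : seq A) (rho : seq nat) : {subset rho <= iota 0 (size zs)} ->
    [seq nth (uzero V) (map (@iotaS k A) zs) i | i <- rho] =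
    map (@iotaS k A) [seq nth 0 zs i | i <- rho].
  move=> rhoP; rewrite -map_comp; apply/eq_in_map => i /rhoP.
  by rewrite mem_iota => /= ?; rewrite (nth_map 0).
have szs : size sigma = size ys.
  by move: sigmaP; rewrite mem_permutations => /perm_size; rewrite size_iota.
have sub_sigma : {subset sigma <= iota 0 (size ys)}.
  by move: sigmaP; rewrite mem_permutations => /perm_mem E i; rewrite E.
rewrite !nthE => [|i /mem_take|i]; [|exact: sub_sigma|]; last first.
  by move: tauP; rewrite mem_permutations => /perm_mem ->.
have /sub_sigma : nth 0%N sigma (size ys).-1 \in sigma.
  by apply: mem_nth; rewrite szs ltn_predL (ltnW ys1).
by rewrite mem_iota => /= lt_ys; rewrite (nth_map 0) // homog_pSU.
Qed.

End Bilinear.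

Theorem mainTheorem13 (k : fieldType) (hk : [pchar k] =i pred0)
  (A : lmodType k) (mulA : A -> A -> A)
  (mulA_linl : forall (c : k) (x x' y : A),
      mulA (c *: x + x') y = c *: mulA x y + mulA x' y)
  (mulA_linr : forall (c : k) (x y y' : A),
      mulA x (c *: y + y') = c *: mulA x y + mulA x y') :
  (forall (xs : seq A) (y z : A),
      symeq (@bracketSU k (kG mulA) (map (@iotaS k A) xs) (iotaS y) (iotaS z))
            (jS (@bracketSU k (Asharp mulA) (map (@embA k A mulA) xs) (embA mulA y) (embA mulA z))))
  /\
  (forall (xs ys : seq A), (0 < size xs)%N -> (1 < size ys)%N ->
      symeq (@PhiSU k (kG mulA) (map (@iotaS k A) xs) (map (@iotaS k A) ys))
            (jS (@PhiSU k (Asharp mulA) (map (@embA k A mulA) xs) (map (@embA k A mulA) ys)))).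
Proof.
have phiM := phiGM mulA_linl mulA_linr.
have [phiD phiN] := (@phiGD k A mulA, @phiGN k A mulA).
have [phi1 phi0] := (@phiG1 k A mulA, @phiG0 k A mulA).
have phiZ := @phiGZ k A mulA.
have iotaE xs : map (@phiG k A mulA) (map (@iotaS k A) xs) = map (@embA k A mulA) xs.
  by rewrite -map_comp; apply: eq_map => x; apply: phiG_iota.
split=> [xs y z|xs ys _ ys1].
  (* The operation in the hull is [phiG] of the one in [kG], so it remains to recover an element of
     degree 1 from its image under [phiG]. *)
  rewrite -iotaE -!phiG_iota -bracketSU_morph //; apply: homog_symeq.
  case: xs => [|x xs]; first exact/homog_opp/homog_comm.
  apply: homog_add; first apply: homog_opp;
    exact: (homog_pSU hk mulA_linl mulA_linr (x :: xs) [:: _]).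
rewrite -!iotaE -PhiSU_morph //; apply: homog_symeq.
exact: homog_PhiSU.
Qed.
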